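(* Let $X$ be a Banach space and let $Y$ be a separable subspace of $X$. Then $\mathrm{Env}(Y)$ is the maximum (with respect to inclusion) among the subspaces $Z$ of $X$ with the following properties: (1) $Z$ contains $Y$; (2) any embedding $t\in\mathrm{Emb}_s(Y,X)$ extends uniquely to an embedding $\tilde t\in\mathrm{Emb}_s(Z,X)$; (3) the mapping $t\mapsto\tilde t$ is SOT-SOT continuous.
   Context: $\mathrm{Isom}(X)$ is the group of surjective linear isometries of $X$; $\mathrm{Emb}(Y,X)$ is the set of linear isometric embeddings of $Y$ into $X$. SOT denotes the topology of pointwise norm convergence. $\mathrm{Emb}_s(Y,X)$ is the SOT-closure in $\mathrm{Emb}(Y,X)$ of $\{T|_Y: T\in\mathrm{Isom}(X)\}$. The isometric envelope $\mathrm{Env}(Y)$ is the set of $x\in X$ such that whenever a net $(T_i)_{i}$ in $\mathrm{Isom}(X)$ satisfies $T_i y\to y$ for every $y\in Y$, then $T_i x\to x$. *)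

(* Defs.v *)
From HB Require Import structures.
From mathcomp Require Import all_boot all_order all_algebra.
From mathcomp Require Import all_classical all_reals all_analysis.
Import Order.TTheory GRing.Theory Num.Theory.
Import numFieldNormedType.Exports.

Set Implicit Arguments.
Unset Strict Implicit.
Unset Printing Implicit Defensive.

Local Open Scope classical_set_scope.
Local Open Scope ring_scope.

(* A subset Y of X, coerced to a type by set_type, carries the subspace
   topology; {ptws Y -> X} is the space of all functions from Y to X with the
   topology of pointwise norm convergence (SOT). *)

Definition separable (T : topologicalType) : Prop :=
  exists2 D : set T, countable D & dense D.

Definition is_maximum (T : Type) (P : set (set T)) (M : set T) : Prop :=
  P M /\ forall Z, P Z -> Z `<=` M.

Record directed (I : Type) (le : I -> I -> Prop) : Prop := Directed {
  directed_inhabited : inhabited I ;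
  directed_refl : forall i, le i i ;
  directed_trans : forall i j k, le i j -> le j k -> le i k ;
  directed_ub : forall i j, exists2 k, le i k & le j k }.

Definition tails (I : Type) (le : I -> I -> Prop) : set_system I :=
  [set A | exists i0, forall i, le i0 i -> A i].

(* The scalar field is any numFieldType, which covers both real and complex
   Banach spaces. *)
Section Envelope.
Variables (K : numFieldType) (X : completeNormedModType K).

Definition subspace_set (Y : set X) : Prop := submod_closed (mem Y).

Definition Isom : set {linear X -> X} :=
  [set T | (forall x, `|T x| = `|x|) /\ (forall y, exists x, T x = y)].

(* Meaningful when Y is a linear subspace. The first condition is linearity of
   t, stated without giving the type Y its own vector space structure. *)
Definition Emb (Y : set X) : set {ptws Y -> X} :=
  [set t | (forall (a : K) (u v w : Y),
              val w = a *: val u + val v -> t w = a *: t u + t v)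
           /\ (forall y : Y, `|t y| = `|val y|)].

Definition restr (Y : set X) (T : {linear X -> X}) : {ptws Y -> X} :=
  fun y => T (val y).

Definition Emb_s (Y : set X) : set {ptws Y -> X} :=
  @Emb Y `&` closure (restr (Y := Y) @` Isom).

Definition Env (Y : set X) : set X :=
  [set x | forall (I : Type) (le : I -> I -> Prop) (T : I -> {linear X -> X}),
     directed le -> (forall i, Isom (T i)) ->
     (forall y, Y y -> (fun i => T i y) @ tails le --> y) ->
     (fun i => T i x) @ tails le --> x].

Definition extends (Y Z : set X) (t : {ptws Y -> X}) (t' : {ptws Z -> X}) :
    Prop :=
  forall (y : Y) (z : Z), val z = val y -> t' z = t y.

Definition unique_extension (Y Z : set X) : Prop :=
  forall t : @Emb_s Y, exists! t' : @Emb_s Z, extends (val t) (val t').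

(* Under unique_extension Y Z, the function E is the mapping t |-> t~ ;
   Emb_s Y and Emb_s Z carry the subspace topologies induced by the SOT. *)
Definition extension_continuous (Y Z : set X) : Prop :=
  exists2 E : @Emb_s Y -> @Emb_s Z,
    (forall t, extends (val t) (val (E t))) & continuous E.

End Envelope.

Lemma tails_filter (I : Type) (le : I -> I -> Prop) :
  directed le -> ProperFilter (tails le).
Proof.
move=> [[i0] lexx letr leub]; split.
  by move=> [i /(_ i (lexx i))].
split.
- by exists i0.
- move=> A B [i iA] [j jB]; have [k ik jk] := leub i j.
  exists k => l kl; split; [apply: iA|apply: jB]; exact: letr kl.
- by move=> A B AB [i iA]; exists i => j /iA /AB.
Qed.

(* Subspaces are not required to be closed. Since envelopes are closed, a
   statement that Env Y is maximum among the linear subspaces with some property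
   also says that it is maximum among the closed ones. *)
Lemma closed_Env (K : numFieldType) (X : completeNormedModType K) (Y : set X) :
  closed (Env Y).
Proof.
move=> x clx I le T dle isoT TY.
have tF := tails_filter dle.
apply/cvgrPdist_lt => e e0.
have e30 : 0 < e / 3%:R by rewrite divr_gt0.
have [z [Ez xz]] := clx _ (nbhsx_ballx x _ e30).
move: xz; rewrite -ball_normE /= => xz.
have /cvgrPdist_lt/(_ _ e30) := Ez I le T dle isoT TY.
apply: filterS => i zT.
have -> : x - T i x = (x - z) + (z - T i z) + T i (z - x).
  by rewrite linearB /= !subrKA.
have -> : e = e / 3%:R + e / 3%:R + e / 3%:R.
  by rewrite -mulr2n -mulrSr -[RHS]mulr_natr divfK ?pnatr_eq0.
rewrite (le_lt_trans (ler_normD _ _))// ltrD//.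
  by rewrite (le_lt_trans (ler_normD _ _))// ltrD.
by rewrite (isoT i).1 distrC.
Qed.

(* Main.v *)
Require Import Defs.
From HB Require Import structures.
From mathcomp Require Import all_boot all_order all_algebra.
From mathcomp Require Import all_classical all_reals all_analysis.
Import Order.TTheory GRing.Theory Num.Theory.
Import numFieldNormedType.Exports.

(** The isometry group acts by isometries, so for S and T in it the distance
    from S x to T x equals the distance from x to R x with R = S^-1 T again in
    the group. A statement about isometries near the identity is therefore
    automatically a uniform statement about pairs of isometries near each other.

    Membership of x in Env Y, tested on the net indexed by pairs (finite subset
    of Y, tolerance), amounts to a finite modulus: for each e > 0 there are a
    finite set s in Y and d > 0 such that an isometry moving the points of s by
    less than d moves x by less than e ([Env_modulus_id]). Applied to S^-1 T this
    compares any two isometries at x ([Env_modulus]).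

    The modulus gives the three properties of Env Y. If isometries converge
    pointwise on Y to an embedding f, they are pointwise Cauchy on Env Y, and
    completeness of X provides the extension of f ([Emb_s_extend]). The modulus
    passes to limits of isometries ([extension_modulus]), where it says that
    extensions of embeddings close on s are close at x. Two extensions of the
    same embedding are thus equal, and extending is SOT-continuous.

    Conversely, suppose that embeddings extend uniquely and continuously from Y
    to Z, and let T_i be isometries converging to the identity on Y. The unique
    extension of the restriction of T_i to Y is its restriction to Z, so
    continuity forces T_i to converge to the identity on Z: every point of Z is
    in Env Y ([extension_sub_Env]). *)

Set Implicit Arguments.
Unset Strict Implicit.
Unset Printing Implicit Defensive.

Local Open Scope classical_set_scope.
Local Open Scope ring_scope.

(** * Filters and subspace topologies *)

Lemma near_all_seq (T : Type) (I : eqType) (G : set_system T) {FG : Filter G}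
    (s : seq I) (P : I -> T -> Prop) :
  (forall i, \forall x \near G, P i x) ->
  \forall x \near G, forall i, i \in s -> P i x.
Proof.
move=> GP; elim: s => [|i s IHs]; first by apply: filterE => x i.
by apply: filterS2 (GP i) IHs => x Pi Ps j /predU1P[->//|]; exact: Ps.
Qed.

(** The topology of A is the initial one for its inclusion into T. *)
Lemma cvg_set_type (S : Type) (T : topologicalType) (A : set T)
    (G : set_system S) {FG : Filter G} (h : S -> A) (t : A) :
  val (h x) @[x --> G] --> val t -> h @ G --> t.
Proof.
move=> Gt U [/= _ [[W oW <-] /= Wt] sWU].
have GW : G [set x | W (val (h x))].
  by apply: (Gt W); exact: open_nbhs_nbhs.
suff: G (h @^-1` U) by [].
by apply: filterS GW => x; exact: sWU.
Qed.

(** * The isometry group and its pointwise limits *)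

Section IsometryGroup.
Variables (K : numFieldType) (X : completeNormedModType K).
Implicit Types (S T : {linear X -> X}) (Y Z : set X).

Lemma Isom_norm T x : Isom T -> `|T x| = `|x|.
Proof. by case. Qed.

Lemma Isom_dist T x y : Isom T -> `|T x - T y| = `|x - y|.
Proof. by move=> isoT; rewrite -linearB Isom_norm. Qed.

Lemma Isom_inj T : Isom T -> injective T.
Proof.
move=> isoT x y Txy; apply/eqP; rewrite -subr_eq0 -normr_eq0.
by rewrite -(Isom_dist _ _ isoT) Txy subrr normr0.
Qed.

Lemma Isom_idfun : Isom (idfun : {linear X -> X}).
Proof. by split=> // y; exists y. Qed.

(** R is S^-1 T. Linearity of R is read off through the injective map S. *)
Lemma Isom_div S T : Isom S -> Isom T ->
  exists2 R : {linear X -> X}, Isom R & forall x, S (R x) = T x.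
Proof.
move=> isoS isoT; have [R SR] := choice (fun x => isoS.2 (T x)).
have linR : linear R.
  by move=> a u v; apply: (Isom_inj isoS); rewrite linearP !SR linearP.
pose mR := GRing.isLinear.Build K X X *:%R R linR.
pose L : {linear X -> X} := HB.pack R mR.
have SL x : S (L x) = T x := SR x.
exists L => //; split=> [x|y].
  by rewrite -(Isom_norm x isoT) -SL (Isom_norm _ isoS).
have [x Tx] := isoT.2 (S y).
by exists x; apply: (Isom_inj isoS); rewrite SL.
Qed.

(** Points of the closure are limits of restrictions to Z; the limit is taken
    here along a filter on the isometries themselves, which are also defined
    outside Z. *)
Lemma closure_restrP Z (t : {ptws Z -> X}) :
  closure (restr (Y := Z) @` @Isom K X) t <->
  exists2 G : set_system {linear X -> X}, ProperFilter G &
    G (@Isom K X) /\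
    forall z : Z, (fun T : {linear X -> X} => T (val z)) @ G --> t z.
Proof.
split=> [clt|[G PG [GI Gt]]].
  (* The trace on the isometries of the preimage of the neighborhoods of t. *)
  pose G := filter_from (nbhs t)
    (fun U => @Isom K X `&` restr (Y := Z) @^-1` U).
  have FG : Filter G.
    apply: filter_from_filter; first by exists setT; exact: filterT.
    move=> U V tU tV; exists (U `&` V); first exact: filterI.
    by move=> T [IT [UT VT]]; split.
  exists G.
    apply: filter_from_proper => U /clt[_ [[T IT <-] UT]].
    by exists T.
  split; first by exists setT => [|T []//]; exact: filterT.
  suff /pointwise_cvgP Gt : restr (Y := Z) T @[T --> G] --> t by exact: Gt.
  by move=> U tU; exists U => // T [].
move=> U tU; have /pointwise_cvgP/(_ _ tU) GU :
  forall z : Z, (f z) @[f --> restr (Y := Z) @ G] --> t z by exact: Gt.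
have /filter_ex[T [IT UT]] : G (@Isom K X `&` restr (Y := Z) @^-1` U).
  exact: filterI.
by exists (restr T); split=> //; exists T.
Qed.

(** Linear relations and norms are preserved by pointwise limits, so a pointwise
    limit of restricted isometries is an embedding. *)
Lemma closure_restr_Emb Z :
  closure (restr (Y := Z) @` @Isom K X) `<=` @Emb K X Z.
Proof.
move=> t /closure_restrP[G PG [GI Gt]]; split=> [a u v w wE|z].
  have TwE : (fun T : {linear X -> X} => T (val w)) =
      (fun T : {linear X -> X} => a *: T (val u) + T (val v)).
    by apply/funext => T; rewrite wE linearP.
  apply: (cvg_unique (@norm_hausdorff _ X) (Gt w)); rewrite TwE.
  by apply: cvgD (Gt v); apply: cvgZr; exact: Gt.
apply: (cvg_unique (@norm_hausdorff _ K) (cvg_norm (Gt z))).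
by apply: cvg_near_cst; apply: filterS GI => T /Isom_norm ->.
Qed.

Lemma restr_Emb_s Z T : Isom T -> @Emb_s K X Z (restr T).
Proof.
move=> IT; have clT : closure (restr (Y := Z) @` @Isom K X) (restr T).
  by apply: subset_closure; exists T.
by split=> //; exact: closure_restr_Emb clT.
Qed.

(** * The finite modulus of a point of the envelope *)

Lemma Env_subspace Y : subspace_set (Env Y).
Proof.
split=> [|a u v /set_mem uY /set_mem vY]; apply/mem_set => I le T dle isoT TY.
  have := tails_filter dle => tF.
  under eq_fun => i do rewrite linear0.
  exact: cvg_cst.
have := tails_filter dle => tF.
under eq_fun => i do rewrite linearP.
by apply: cvgD; [apply: cvgZr; exact: uY|exact: vY].
Qed.

Lemma sub_Env Y : Y `<=` Env Y.
Proof. by move=> y Yy I le T _ _; exact. Qed.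

(** If no pair (s, d) works for e, choose for each pair an isometry violating the
    bound. These isometries form a net converging to the identity on Y but not
    at x. *)
Lemma Env_modulus_id Y x (e : K) : Env Y x -> 0 < e ->
  exists (s : seq Y) (d : K), 0 < d /\ forall T, Isom T ->
    (forall y, y \in s -> `|val y - T (val y)| < d) -> `|x - T x| < e.
Proof.
move=> xY e0; apply: contrapT => nmod.
pose I := (seq Y * {d : K | 0 < d})%type.
pose le (i j : I) := {subset i.1 <= j.1} /\ val j.2 <= val i.2.
have bad (i : I) : exists T, [/\ Isom T,
    forall y, y \in i.1 -> `|val y - T (val y)| < val i.2 &
    ~ `|x - T x| < e].
  apply: contrapT => nbad; apply: nmod; exists i.1, (val i.2).
  split=> [|T IT Ts]; first exact: valP.
  by apply: contrapT => nT; apply: nbad; exists T.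
have [T Tbad] := choice bad.
have dle : directed le.
  split=> [|i|i j k [ij dij] [jk djk]|i j].
  - by constructor; exact: ([::], exist _ 1 ltr01).
  - by split.
  - by split=> [y /ij/jk//|]; exact: le_trans djk dij.
  (* K need not be totally ordered, but nonnegative elements are comparable, so
     one of the two tolerances is the smaller. *)
  have := ger_leVge (ltW (valP i.2)) (ltW (valP j.2)).
  have subl : {subset i.1 <= i.1 ++ j.1} by move=> y yi; rewrite mem_cat yi.
  have subr : {subset j.1 <= i.1 ++ j.1}.
    by move=> y yj; rewrite mem_cat yj orbT.
  by case/orP=> dij; [exists (i.1 ++ j.1, i.2)|exists (i.1 ++ j.1, j.2)].
have tF := tails_filter dle.
have TY y : Y y -> (fun i => T i y) @ tails le --> y.
  move=> Yy; apply/cvgrPdist_lt => d d0.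
  exists ([:: SigSub (mem_set Yy)], exist _ d d0) => i [/= yi di].
  have [_ /(_ (SigSub (mem_set Yy))) Ti _] := Tbad i.
  by apply: lt_le_trans di; apply: Ti; apply: yi; rewrite inE.
have isoT i : Isom (T i) by case: (Tbad i).
have /cvgrPdist_lt/(_ _ e0)/filter_ex[i] := xY _ _ _ dle isoT TY.
by case: (Tbad i).
Qed.

(** The version of the modulus invariant under the isometry group: compare S and
    T through the isometry S^-1 T. *)
Lemma Env_modulus Y x (e : K) : Env Y x -> 0 < e ->
  exists (s : seq Y) (d : K), 0 < d /\ forall S T, Isom S -> Isom T ->
    (forall y, y \in s -> `|S (val y) - T (val y)| < d) -> `|S x - T x| < e.
Proof.
move=> /Env_modulus_id/[apply] -[s [d [d0 sd]]]; exists s, d.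
split=> // S T IS IT.
have [R IR SR] := Isom_div IS IT => ST.
rewrite -SR Isom_dist//; apply: sd => // y /ST.
by rewrite -SR Isom_dist.
Qed.

Lemma dist_lt3 (a b c d : X) (e : K) :
  `|a - b| < e / 3 -> `|b - c| < e / 3 -> `|d - c| < e / 3 -> `|a - d| < e.
Proof.
move=> ab bc dc; have -> : a - d = (a - b) + (b - c) + (c - d).
  by rewrite !subrKA.
have -> : e = e / 3 + e / 3 + e / 3.
  by rewrite -mulr2n -mulrSr -[RHS]mulr_natr divfK ?pnatr_eq0.
rewrite (le_lt_trans (ler_normD _ _))// ltrD// 1?distrC//.
by rewrite (le_lt_trans (ler_normD _ _))// ltrD.
Qed.

(** The modulus survives pointwise limits: approximate the two extensions by
    isometries, simultaneously at z and on the finite set s. *)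
Lemma extension_modulus Y Z (z : Z) (e : K) :
  Y `<=` Z -> Env Y (val z) -> 0 < e ->
  exists (s : seq Y) (d : K), 0 < d /\
    forall (f g : {ptws Y -> X}) (f' g' : {ptws Z -> X}),
      Emb_s f' -> Emb_s g' -> extends f f' -> extends g g' ->
      (forall y, y \in s -> `|f y - g y| < d) -> `|f' z - g' z| < e.
Proof.
move=> YZ zY e0; have e3 : 0 < e / 3 by rewrite divr_gt0.
have [s [d [d0 sd]]] := Env_modulus zY e3.
have d3 : 0 < d / 3 by rewrite divr_gt0.
exists s, (d / 3); split=> // f g f' g' f's g's ff' gg' fg.
have approx (h : {ptws Y -> X}) (h' : {ptws Z -> X}) : Emb_s h' ->
    extends h h' -> exists T, [/\ Isom T, `|h' z - T (val z)| < e / 3 &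
      forall y, y \in s -> `|h y - T (val y)| < d / 3].
  move=> [_ /closure_restrP[G PG [GI Gh']]] hh'.
  have Gz : G [set T : {linear X -> X} | `|h' z - T (val z)| < e / 3].
    by have /cvgrPdist_lt := Gh' z; exact.
  have Gy (y : Y) : G [set T : {linear X -> X} | `|h y - T (val y)| < d / 3].
    pose y' : Z := SigSub (mem_set (YZ _ (set_valP y))).
    by rewrite -(hh' y y' erefl); have /cvgrPdist_lt := Gh' y'; exact.
  have Gs : G [set T : {linear X -> X} |
      forall y, y \in s -> `|h y - T (val y)| < d / 3].
    exact: near_all_seq.
  have [T [IT [zT sT]]] := filter_ex (filterI GI (filterI Gz Gs)).
  by exists T.
have [S [IS zS sS]] := approx f f' f's ff'.
have [T [IT zT sT]] := approx g g' g's gg'.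
apply: dist_lt3 zS _ zT; apply: sd => // y ys.
apply: (dist_lt3 (b := f y) (c := g y)); last 1 first.
- by rewrite distrC; exact: sT.
- by rewrite distrC; exact: sS.
- exact: fg.
Qed.

(** * Extension of embeddings to the envelope *)

(** By the modulus, isometries converging pointwise on Y are pointwise Cauchy
    on Z. *)
Lemma Emb_s_extend Y Z (f : {ptws Y -> X}) :
  Y `<=` Z -> Z `<=` Env Y -> Emb_s f ->
  exists2 f' : {ptws Z -> X}, Emb_s f' & extends f f'.
Proof.
move=> YZ ZE [_ /closure_restrP[G PG [GI Gf]]].
have lims (z : Z) :
    exists x : X, (fun T : {linear X -> X} => T (val z)) @ G --> x.
  apply/cvg_ex; apply: cauchy_cvg; apply: cauchy_exP => e e0.
  have [s [d [d0 sd]]] := Env_modulus (ZE _ (set_valP z)) e0.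
  have d2 : 0 < d / 2 by rewrite divr_gt0.
  have Gs : G [set T : {linear X -> X} | Isom T /\
      forall y, y \in s -> `|f y - T (val y)| < d / 2].
    apply: filterI => //; apply: near_all_seq => y.
    by have /cvgrPdist_lt := Gf y; exact.
  have [S [IS Ss]] := filter_ex Gs.
  exists (S (val z)).
  suff: G [set T : {linear X -> X} | ball (S (val z)) e (T (val z))] by [].
  apply: filterS Gs => T [IT Ts].
  rewrite -ball_normE /=; apply: sd => // y ys.
  rewrite -(subrK (f y) (S (val y))) -addrA [d]splitr.
  rewrite (le_lt_trans (ler_normD _ _))// ltrD//; last exact: Ts.
  by rewrite distrC; exact: Ss.
have [f' Gf'] := choice lims.
have clf' : closure (restr (Y := Z) @` @Isom K X) (f' : {ptws Z -> X}).
  by apply/closure_restrP; exists G.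
exists f'; first by split=> //; exact: closure_restr_Emb clf'.
move=> y z zy; apply: (cvg_unique (@norm_hausdorff _ X) (Gf' z)).
by rewrite zy; exact: Gf.
Qed.

(** If two extensions had a nonzero distance e at z, the modulus for e, with the
    same embedding of Y on both sides, would give e < e. *)
Lemma Emb_s_extension_unique Y Z (f : {ptws Y -> X}) (f' g' : {ptws Z -> X}) :
  Y `<=` Z -> Z `<=` Env Y -> Emb_s f' -> Emb_s g' ->
  extends f f' -> extends f g' -> f' = g'.
Proof.
move=> YZ ZE f's g's ff' fg'; apply/funext => z.
apply/eqP; rewrite -subr_eq0 -normr_eq0; apply: contraT => nz.
have e0 : 0 < `|f' z - g' z| by rewrite lt_def nz normr_ge0.
have [s [d [d0 /(_ f f f' g' f's g's ff' fg')]]] :=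
  extension_modulus YZ (ZE _ (set_valP z)) e0.
by rewrite ltxx; apply => y _; rewrite subrr normr0.
Qed.

Lemma Env_unique_extension Y Z :
  Y `<=` Z -> Z `<=` Env Y -> unique_extension Y Z.
Proof.
move=> YZ ZE f; have [f' f's ff'] := Emb_s_extend YZ ZE (set_valP f).
exists (SigSub (mem_set f's)); split=> // g' fg'; apply: val_inj => /=.
exact: Emb_s_extension_unique YZ ZE f's (set_valP g') ff' fg'.
Qed.

(** The modulus only involves the values of an embedding on a finite subset of Y,
    and closeness there is an SOT-neighborhood. *)
Lemma Env_extension_continuous Y Z :
  Y `<=` Z -> Z `<=` Env Y -> extension_continuous Y Z.
Proof.
move=> YZ ZE; have ext (f : @Emb_s K X Y) :
    exists f' : @Emb_s K X Z, extends (val f) (val f').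
  by have [f' [ff' _]] := Env_unique_extension YZ ZE f; exists f'.
have [E fE] := choice ext.
exists E => //; apply: continuous_comp_initial => f.
have Ff : Filter (nbhs f) by exact: nbhs_filter.
apply/pointwise_cvgP => z; apply/cvgrPdist_lt => e e0.
have [s [d [d0 sd]]] := extension_modulus YZ (ZE _ (set_valP z)) e0.
have fs : nbhs f [set g : @Emb_s K X Y | forall y, y \in s ->
    `|val f y - val g y| < d].
  apply: (@near_all_seq _ _ (nbhs f) Ff s) => y.
  have /pointwise_cvgP/(_ y)/cvgrPdist_lt := @initial_continuous _ _ set_val f.
  exact.
by apply: filterS fs => g; apply: sd => //; exact: set_valP.
Qed.

(** * Maximality of the envelope *)

(** Along a net of isometries tending to the identity on Y, the extension map
    sends restrictions to Y to restrictions to Z, by uniqueness; its continuity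
    at the inclusion of Y gives convergence on Z. *)
Lemma extension_sub_Env Y Z :
  unique_extension Y Z -> extension_continuous Y Z -> Z `<=` Env Y.
Proof.
move=> uext [E fE cE] z Zz I le T dle isoT TY.
have tF := tails_filter dle.
pose r (W : set X) (S : {linear X -> X}) (IS : Isom S) : @Emb_s K X W :=
  SigSub (mem_set (restr_Emb_s W IS)).
have Er S (IS : Isom S) : E (r Y S IS) = r Z S IS.
  have [f' [_ f'u]] := uext (r Y S IS).
  rewrite -(f'u (E (r Y S IS)) (fE _)); apply: f'u => y x xy.
  exact: (congr1 S xy).
have rY : (fun i => r Y (T i) (isoT i)) @ tails le --> r Y idfun Isom_idfun.
  apply: cvg_set_type; apply/pointwise_cvgP => y.
  exact: TY (set_valP y).
have := cvg_comp _ _ rY (cE _).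
rewrite Er => rZ.
have := cvg_comp _ _ rZ (@initial_continuous _ _ set_val _).
move=> /pointwise_cvgP/(_ (SigSub (mem_set Zz))) /=.
apply: cvg_trans; apply: near_eq_cvg; apply: filterE => i /=.
by rewrite /= Er.
Qed.

End IsometryGroup.

Theorem proposition2p34 (K : numFieldType) (X : completeNormedModType K)
    (Y : set X) (subY : subspace_set Y) (sepY : separable Y) :
  is_maximum
    [set Z : set X | [/\ subspace_set Z,
                         Y `<=` Z,
                         unique_extension Y Z
                       & extension_continuous Y Z]]
    (Env Y).
Proof.
split=> [|Z [_ YZ]]; last exact: extension_sub_Env.
split; [exact: Env_subspace|exact: sub_Env| |].
- by apply: Env_unique_extension => //; exact: sub_Env.
- by apply: Env_extension_continuous => //; exact: sub_Env.
Qed.
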